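(* Every digroup $(G,\stackrel{\rightharpoonup}{\cdot},\stackrel{\leftharpoonup}{\cdot},e)$ is isomorphic to a subdigroup of the digroup $\stackrel{\leftharpoonup}{L}_G\times\stackrel{\rightharpoonup}{L}_G$.
   Context: A digroup $(G,\stackrel{\rightharpoonup}{\cdot},\stackrel{\leftharpoonup}{\cdot},e)$ with identity $e$ is a nonempty set $G$ with two binary operations $\stackrel{\rightharpoonup}{\cdot}$ (left product) and $\stackrel{\leftharpoonup}{\cdot}$ (right product) and an element $e\in G$ such that: 1. (diassociative law) for all $x,y,z\in G$: $x\stackrel{\rightharpoonup}{\cdot}(y\stackrel{\rightharpoonup}{\cdot}z)=(x\stackrel{\rightharpoonup}{\cdot}y)\stackrel{\rightharpoonup}{\cdot}z=x\stackrel{\rightharpoonup}{\cdot}(y\stackrel{\leftharpoonup}{\cdot}z)$; $(x\stackrel{\leftharpoonup}{\cdot}y)\stackrel{\rightharpoonup}{\cdot}z=x\stackrel{\leftharpoonup}{\cdot}(y\stackrel{\rightharpoonup}{\cdot}z)$; $(x\stackrel{\rightharpoonup}{\cdot}y)\stackrel{\leftharpoonup}{\cdot}z=(x\stackrel{\leftharpoonup}{\cdot}y)\stackrel{\leftharpoonup}{\cdot}z=x\stackrel{\leftharpoonup}{\cdot}(y\stackrel{\leftharpoonup}{\cdot}z)$. 2. for all $x\in G$: $x\stackrel{\rightharpoonup}{\cdot}e=x=e\stackrel{\leftharpoonup}{\cdot}x$ and $x\stackrel{\leftharpoonup}{\cdot}e=e\stackrel{\rightharpoonup}{\cdot}x$.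 3. for each $x\in G$ there is an element $x^{\check{-}1}\in G$, called the Liu inverse of $x$, with $x^{\check{-}1}\stackrel{\rightharpoonup}{\cdot}x=e=x\stackrel{\leftharpoonup}{\cdot}x^{\check{-}1}$. A subdigroup of a digroup with identity $e$ is a nonempty subset $H$ with $e\in H$ such that $H$, with the restricted operations, is itself a digroup with identity $e$. A homomorphism from a digroup $(G,e_G)$ to a digroup $(H,e_H)$ is a map $\eta:G\to H$ with $\eta(e_G)=e_H$ and $\eta(x\ast y)=\eta(x)\ast\eta(y)$ for all $x,y\in G$ and for both $\ast=\stackrel{\rightharpoonup}{\cdot}$ and $\ast=\stackrel{\leftharpoonup}{\cdot}$. Two digroups are isomorphic if there is a bijective homomorphism from one to the other. For $a\in G$ define maps $\stackrel{\rightharpoonup}{L}_a,\stackrel{\leftharpoonup}{L}_a:G\to G$ by $\stackrel{\rightharpoonup}{L}_a(x):=a\stackrel{\rightharpoonup}{\cdot}x$ and $\stackrel{\leftharpoonup}{L}_a(x):=a\stackrel{\leftharpoonup}{\cdot}x$ for $x\in G$. Put $\stackrel{\leftharpoonup}{L}_G:=\{\stackrel{\leftharpoonup}{L}_a\mid a\in G\}$ and $\stackrel{\rightharpoonup}{L}_G:=\{\stackrel{\rightharpoonup}{L}_a\mid a\in G\}$. The set $\stackrel{\leftharpoonup}{L}_G\times\stackrel{\rightharpoonup}{L}_G$ is made into a digroup by $$(\stackrel{\leftharpoonup}{L}_a,\stackrel{\rightharpoonup}{L}_b)\stackrel{\rightharpoonup}{\cdot}(\stackrel{\leftharpoonup}{L}_c,\stackrel{\rightharpoonup}{L}_d)=(\stackrel{\leftharpoonup}{L}_{a\stackrel{\rightharpoonup}{\cdot}c},\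 \stackrel{\rightharpoonup}{L}_{b\stackrel{\rightharpoonup}{\cdot}d}),\qquad (\stackrel{\leftharpoonup}{L}_a,\stackrel{\rightharpoonup}{L}_b)\stackrel{\leftharpoonup}{\cdot}(\stackrel{\leftharpoonup}{L}_c,\stackrel{\rightharpoonup}{L}_d)=(\stackrel{\leftharpoonup}{L}_{a\stackrel{\leftharpoonup}{\cdot}c},\ \stackrel{\rightharpoonup}{L}_{b\stackrel{\leftharpoonup}{\cdot}d})$$ for $a,b,c,d\in G$, with identity $(\stackrel{\leftharpoonup}{L}_e,\stackrel{\rightharpoonup}{L}_e)$; the Liu inverse of $(\stackrel{\leftharpoonup}{L}_a,\stackrel{\rightharpoonup}{L}_b)$ is $(\stackrel{\leftharpoonup}{L}_{a^{\check{-}1}},\stackrel{\rightharpoonup}{L}_{b^{\check{-}1}})$. *)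

(* Defs.v *)
From mathcomp Require Import all_boot boolp classical_sets.

Set Implicit Arguments.
Unset Strict Implicit.
Unset Printing Implicit Defensive.

Local Open Scope classical_set_scope.

Reserved Notation "x ⇀ y" (at level 40, left associativity).
Reserved Notation "x ↽ y" (at level 40, left associativity).

Record is_digroup (T : Type) (l r : T -> T -> T) (e : T) : Prop := IsDigroup {
  dg_llA : forall x y z, l x (l y z) = l (l x y) z;
  dg_lrA : forall x y z, l (l x y) z = l x (r y z);
  dg_rlA : forall x y z, l (r x y) z = r x (l y z);
  dg_lrC : forall x y z, r (l x y) z = r (r x y) z;
  dg_rrA : forall x y z, r (r x y) z = r x (r y z);
  dg_le : forall x, l x e = x;
  dg_er : forall x, r e x = x;
  dg_re : forall x, r x e = l e x;
  dg_inv : forall x, exists y, l y x = e /\ r x y = e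
}.

Structure digroup := Digroup {
  dg_sort :> Type;
  lmul : dg_sort -> dg_sort -> dg_sort;
  rmul : dg_sort -> dg_sort -> dg_sort;
  dg_e : dg_sort;
  dg_ax : is_digroup lmul rmul dg_e
}.

Arguments dg_e : clear implicits.

Notation "x ⇀ y" := (lmul x y).
Notation "x ↽ y" := (rmul x y).

Definition closed_op (T : Type) (op : T -> T -> T) (S : set T) : Prop :=
  forall x y, S x -> S y -> S (op x y).

Definition restr_op (T : Type) (op : T -> T -> T) (S : set T)
    (cS : closed_op op S) (x y : set_type S) : set_type S :=
  SigSub (mem_set (cS _ _ (set_mem (valP x)) (set_mem (valP y)))).

Record subdigroup (G : digroup) := Subdigroup {
  sd_set : set G;
  sd_e : sd_set (dg_e G);
  sd_l : closed_op (@lmul G) sd_set;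
  sd_r : closed_op (@rmul G) sd_set;
  sd_ax : is_digroup (restr_op sd_l) (restr_op sd_r) (SigSub (mem_set sd_e))
}.

Definition digroup_of_sub (G : digroup) (H : subdigroup G) : digroup :=
  Digroup (sd_ax H).
Coercion digroup_of_sub : subdigroup >-> digroup.

Record digroup_hom (G H : digroup) (f : G -> H) : Prop := DigroupHom {
  hom_e : f (dg_e G) = dg_e H;
  hom_l : forall x y, f (x ⇀ y) = f x ⇀ f y;
  hom_r : forall x y, f (x ↽ y) = f x ↽ f y
}.

Definition digroup_isomorphic (G H : digroup) : Prop :=
  exists2 f : G -> H, digroup_hom f & bijective f.

Definition range_elt (A B : Type) (f : A -> B) (a : A) : set_type (range f) :=
  SigSub (mem_set (imageT f a)).

Definition range_rep (A B : Type) (f : A -> B) (b : set_type (range f)) : A :=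
  s2val (cid2 (set_mem (valP b))).

Lemma range_repK (A B : Type) (f : A -> B) : cancel (@range_rep A B f) (range_elt f).
Proof.
by move=> b; apply: val_inj; rewrite /= /range_rep; case: cid2.
Qed.

Lemma range_repE (A B : Type) (f : A -> B) (a : A) :
  f (range_rep (range_elt f a)) = f a.
Proof. exact: (congr1 val (range_repK (range_elt f a))). Qed.

Lemma range_elt_eq (A B : Type) (f : A -> B) (a b : A) :
  f a = f b -> range_elt f a = range_elt f b.
Proof. by move=> fab; apply: val_inj. Qed.

Section LeftTranslations.
Variable G : digroup.

(* Both are multiplications by [a] on the left, for the left product ⇀ and the
   right product ↽ respectively. *)
Definition L_lmul (a : G) : G -> G := fun x => a ⇀ x.
Definition L_rmul (a : G) : G -> G := fun x => a ↽ x.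

Definition LL : Type := (set_type (range L_rmul) * set_type (range L_lmul))%type.

Definition LLelt (a b : G) : LL := (range_elt L_rmul a, range_elt L_lmul b).

(* The products are computed on chosen representatives of the two maps;
   [LL_lmulE] and [LL_rmulE] show that the choice is immaterial. *)
Definition LL_op (op : G -> G -> G) (p q : LL) : LL :=
  LLelt (op (range_rep p.1) (range_rep q.1)) (op (range_rep p.2) (range_rep q.2)).

Definition LL_lmul : LL -> LL -> LL := LL_op (@lmul G).
Definition LL_rmul : LL -> LL -> LL := LL_op (@rmul G).
Definition LL_e : LL := LLelt (dg_e G) (dg_e G).

Lemma L_rmul_l (a c : G) : L_rmul (a ⇀ c) = L_rmul a \o L_rmul c.
Proof. by apply/funext => x; rewrite /L_rmul /= (dg_lrC (dg_ax G)) (dg_rrA (dg_ax G)). Qed.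

Lemma L_rmul_r (a c : G) : L_rmul (a ↽ c) = L_rmul a \o L_rmul c.
Proof. by apply/funext => x; rewrite /L_rmul /= (dg_rrA (dg_ax G)). Qed.

Lemma L_lmul_inj : injective L_lmul.
Proof.
by move=> a b /(congr1 (fun f => f (dg_e G))); rewrite /L_lmul !(dg_le (dg_ax G)).
Qed.

Lemma LL_lmulE (a b c d : G) :
  LL_lmul (LLelt a b) (LLelt c d) = LLelt (a ⇀ c) (b ⇀ d).
Proof.
rewrite /LL_lmul /LL_op /LLelt; congr pair; apply: range_elt_eq => /=.
  by rewrite !L_rmul_l !range_repE.
by rewrite !(L_lmul_inj (range_repE _ _)).
Qed.

Lemma LL_rmulE (a b c d : G) :
  LL_rmul (LLelt a b) (LLelt c d) = LLelt (a ↽ c) (b ↽ d).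
Proof.
rewrite /LL_rmul /LL_op /LLelt; congr pair; apply: range_elt_eq => /=.
  by rewrite !L_rmul_r !range_repE.
by rewrite !(L_lmul_inj (range_repE _ _)).
Qed.

Lemma LLeltP (p : LL) : exists a b, p = LLelt a b.
Proof.
case: p => f g; exists (range_rep f), (range_rep g).
by rewrite /LLelt !range_repK.
Qed.

Lemma LL_inv (a a' b b' : G) :
    a' ⇀ a = dg_e G -> a ↽ a' = dg_e G ->
    b' ⇀ b = dg_e G -> b ↽ b' = dg_e G ->
  LL_lmul (LLelt a' b') (LLelt a b) = LL_e /\
  LL_rmul (LLelt a b) (LLelt a' b') = LL_e.
Proof. by move=> a1 a2 b1 b2; rewrite LL_lmulE LL_rmulE a1 a2 b1 b2. Qed.

Lemma LL_is_digroup : is_digroup LL_lmul LL_rmul LL_e.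
Proof.
have [llA lrA rlA lrC rrA le er re inv] := dg_ax G.
split.
- move=> p q s; have [a [b ->]] := LLeltP p; have [c [d ->]] := LLeltP q.
  by have [u [v ->]] := LLeltP s; rewrite !LL_lmulE !llA.
- move=> p q s; have [a [b ->]] := LLeltP p; have [c [d ->]] := LLeltP q.
  by have [u [v ->]] := LLeltP s; rewrite !(LL_lmulE, LL_rmulE) !lrA.
- move=> p q s; have [a [b ->]] := LLeltP p; have [c [d ->]] := LLeltP q.
  by have [u [v ->]] := LLeltP s; rewrite !(LL_lmulE, LL_rmulE) !rlA.
- move=> p q s; have [a [b ->]] := LLeltP p; have [c [d ->]] := LLeltP q.
  by have [u [v ->]] := LLeltP s; rewrite !(LL_lmulE, LL_rmulE) !lrC.
- move=> p q s; have [a [b ->]] := LLeltP p; have [c [d ->]] := LLeltP q.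
  by have [u [v ->]] := LLeltP s; rewrite !LL_rmulE !rrA.
- by move=> p; have [a [b ->]] := LLeltP p; rewrite LL_lmulE !le.
- by move=> p; have [a [b ->]] := LLeltP p; rewrite LL_rmulE !er.
- by move=> p; have [a [b ->]] := LLeltP p; rewrite LL_lmulE LL_rmulE !re.
- move=> p; have [a [b ->]] := LLeltP p.
  have [a' [? ?]] := inv a; have [b' [? ?]] := inv b.
  by exists (LLelt a' b'); apply: LL_inv.
Qed.

Definition LL_digroup : digroup := Digroup LL_is_digroup.

End LeftTranslations.

(* Main.v *)
(* The diagonal a |-> (L_a, L_a) is a homomorphism by construction of the
   product digroup.  It is injective because its second coordinate recovers a
   as a ⇀ e, so G is isomorphic to its image. *)
Require Import Defs.
From mathcomp Require Import all_boot boolp classical_sets.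

Lemma range_closed_op (A B : Type) (f : A -> B) (opA : A -> A -> A)
    (opB : B -> B -> B) :
  {morph f : x y / opA x y >-> opB x y} -> closed_op opB (range f).
Proof. by move=> fM _ _ [a _ <-] [b _ <-]; exists (opA a b). Qed.

Section EmbeddingImage.
Variables (G K : digroup) (f : G -> K).
Hypotheses (f_hom : digroup_hom f) (f_inj : injective f).

Lemma range_unit : range f (dg_e K).
Proof. by exists (dg_e G); last exact: hom_e f_hom. Qed.

Let range_l := range_closed_op _ _ _ _ _ (hom_l f_hom).
Let range_r := range_closed_op _ _ _ _ _ (hom_r f_hom).

Lemma range_is_digroup :
  is_digroup (restr_op range_l) (restr_op range_r) (SigSub (mem_set range_unit)).
Proof.
have [llA lrA rlA lrC rrA le er re _] := dg_ax K.
(* The identities of [K] restrict to any closed subset; only the existence of inverses remains. *)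
split; try by move=> *; apply: val_inj => /=.
move=> x; have [a _ fa] := set_mem (valP x).
have [b [ba ab]] := dg_inv (dg_ax G) a.
(* The inverse axiom of [K] does not place its witness in the range, so the image of a Liu inverse
   of the preimage [a] is taken. *)
exists (range_elt f b); split; apply: val_inj; rewrite /= -fa.
  by rewrite -(hom_l f_hom) ba (hom_e f_hom).
by rewrite -(hom_r f_hom) ab (hom_e f_hom).
Qed.

Definition range_subdigroup : subdigroup K := Subdigroup range_is_digroup.

Lemma isomorphic_range : digroup_isomorphic G range_subdigroup.
Proof.
exists (range_elt f).
  split=> [|x y|x y]; apply: val_inj => /=.
  - exact: hom_e f_hom.
  - exact: hom_l f_hom x y.
  - exact: hom_r f_hom x y.
(* Choosing a preimage is always a right inverse; injectivity of [f] makes it a left inverse too. *)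
exists (@range_rep _ _ f); last exact: range_repK.
by move=> a; apply: f_inj; exact: range_repE.
Qed.

End EmbeddingImage.

Lemma diagonal_hom (G : digroup) :
  @digroup_hom G (LL_digroup G) (fun a => LLelt a a).
Proof.
by split=> // a b; rewrite /= ?LL_lmulE ?LL_rmulE.
Qed.

Lemma diagonal_inj (G : digroup) : injective (fun a : G => LLelt a a).
(* The second coordinate separates points, whereas [L_rmul] may fail to be injective. *)
Proof. by move=> a b [_ ab]; apply: L_lmul_inj. Qed.

Theorem proposition2p5 (G : digroup) :
  exists H : subdigroup (LL_digroup G), digroup_isomorphic G H.
Proof.
exists (range_subdigroup _ _ _ (diagonal_hom G)).
exact/isomorphic_range/diagonal_inj.
Qed.
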